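(* For any rooted graph $(G,R)$, the group $U(L_{\mathbb{Z}}(G,R))$ of unitary elements equals the set of all elements of the form $$\sum_{b\in B,\,b'\in B'}k_{b,b'}\,b(b')^*,$$ where $B,B'$ are finite maximal bases of $\mathcal{T}(G,R)$, $(k_{b,b'})_{b\in B,b'\in B'}$ is an orthogonal matrix over $\mathbb{Z}$ (of any dimension), and $k_{b,b'}=0$ whenever $T(b)\neq T(b')$.
   Context: Graphs are directed with multiple edges and loops allowed: $G=(VG,EG,o,t)$ with origin and terminus maps $o,t:EG\to VG$. All graphs are locally finite: $|o^{-1}(v)|<\infty$ for every $v\in VG$. A path is either an empty path $\varepsilon_v$ ($v\in VG$) or a word $e_1\dots e_n$ ($n\ge 1$) of edges with $t(e_i)=o(e_{i+1})$. $\mathcal{W}(G)$ is the set of all paths; $O(e_1\dots e_n)=o(e_1)$, $T(e_1\dots e_n)=t(e_n)$, $O(\varepsilon_v)=T(\varepsilon_v)=v$; $\mathcal{W}(G,v)$ is the set of paths $p$ with $O(p)=v$. A rooted graph $(G,R)$ is a graph $G$ with a vertex $R$ (the root) from which every vertex can be reached by a directed path. The unfolding tree $\mathcal{T}(G,R)$ has vertex set $\mathcal{W}(G,R)$ and edges $(p,pe)$. A path $p$ is a prefix of $q$ ($p\preceq q$) if $q=pr$ for some path $r$. A set of paths is independent if none of its elements is a prefix of another one. A finite maximal basis of $\mathcal{T}(G,R)$ is a finite independent subset of $\mathcal{W}(G,R)$ that is inclusion-maximal among independent subsets. The Leavitt path algebra $L_{\mathbb{Z}}(G)$ is the $\mathbb{Z}$-algebra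 generated by $VG\sqcup\{e,e^*\mid e\in EG\}$ with relations: $vw=\delta_{v,w}v$ for $v,w\in VG$; $e^*e'=0$ if $e\ne e'$ and $e^*e=t(e)$; $o(e)e=e\,t(e)=e$; $t(e)e^*=e^*o(e)=e^*$; and $v=\sum_{e\in o^{-1}(v)}ee^*$ whenever $o^{-1}(v)\neq\emptyset$. It has the linear involution $*$ with $(xy)^*=y^*x^*$, $v^*=v$, $(e)^*=e^*$, $(e^* )^*=e$. A path $p=e_1\dots e_n$ is viewed as the product of its edges, $p^*=e_n^*\dots e_1^*$, and $\varepsilon_v=v$. The rooted Leavitt path algebra $L_{\mathbb{Z}}(G,R)$ is the $\mathbb{Z}$-submodule of $L_{\mathbb{Z}}(G)$ generated by $\{pq^*\mid p,q\in\mathcal{W}(G,R),\ T(p)=T(q)\}$; it is a $*$-subalgebra with unit $R$. Its unitary group is $U(L_{\mathbb{Z}}(G,R))=\{x\in L_{\mathbb{Z}}(G,R)\mid xx^*=x^*x=R\}$. *)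

(* Defs.v *)
From HB Require Import structures.
From mathcomp Require Import all_boot all_order all_algebra.
From mathcomp Require Import finmap generic_quotient.
From mathcomp Require Import boolp classical_sets cardinality.

Set Implicit Arguments.
Unset Strict Implicit.
Unset Printing Implicit Defensive.

Import GRing.Theory.
Local Open Scope classical_set_scope.
Local Open Scope ring_scope.
Local Open Scope quotient_scope.

(* Non-unital associative rings (i.e. Z-algebras) presented by generators and *)
(* relations.  No unit is adjoined: a Leavitt path algebra is non-unital as   *)
(* soon as the graph has infinitely many vertices.                            *)

Inductive rterm (X : Type) : Type :=
| RGen of X
| RZero
| ROpp of rterm X
| RAdd of rterm X & rterm X
| RMul of rterm X & rterm X.

Arguments RZero {X}.

HB.instance Definition _ (X : Type) := gen_eqMixin (rterm X).
HB.instance Definition _ (X : Type) := gen_choiceMixin (rterm X).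

(* The least congruence containing S modulo which the terms form a ring.      *)
Inductive rcong (X : Type) (S : rterm X -> rterm X -> Prop) :
  rterm X -> rterm X -> Prop :=
| rcong_rel x y : S x y -> rcong S x y
| rcong_refl x : rcong S x x
| rcong_sym x y : rcong S x y -> rcong S y x
| rcong_trans y x z : rcong S x y -> rcong S y z -> rcong S x z
| rcong_opp x x' : rcong S x x' -> rcong S (ROpp x) (ROpp x')
| rcong_add x x' y y' :
    rcong S x x' -> rcong S y y' -> rcong S (RAdd x y) (RAdd x' y')
| rcong_mul x x' y y' :
    rcong S x x' -> rcong S y y' -> rcong S (RMul x y) (RMul x' y')
| rcong_addA x y z : rcong S (RAdd x (RAdd y z)) (RAdd (RAdd x y) z)
| rcong_addC x y : rcong S (RAdd x y) (RAdd y x)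
| rcong_add0 x : rcong S (RAdd RZero x) x
| rcong_addN x : rcong S (RAdd (ROpp x) x) RZero
| rcong_mulA x y z : rcong S (RMul x (RMul y z)) (RMul (RMul x y) z)
| rcong_mulDl x y z : rcong S (RMul (RAdd x y) z) (RAdd (RMul x z) (RMul y z))
| rcong_mulDr x y z : rcong S (RMul x (RAdd y z)) (RAdd (RMul x y) (RMul x z)).

Section Presentation.
Variables (X : Type) (S : rterm X -> rterm X -> Prop).

Definition rcongb : rel (rterm X) := fun x y => `[< rcong S x y >].

Lemma rcongb_refl : reflexive rcongb.
Proof. by move=> x; apply/asboolP; apply: rcong_refl. Qed.

Lemma rcongb_sym : symmetric rcongb.
Proof. by move=> x y; apply/asboolP/asboolP; apply: rcong_sym. Qed.

Lemma rcongb_trans : transitive rcongb.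
Proof.
by move=> y x z /asboolP xy /asboolP yz; apply/asboolP; apply: rcong_trans yz.
Qed.

Canonical rcongb_equiv := EquivRel rcongb rcongb_refl rcongb_sym rcongb_trans.

Definition presented : Type := {eq_quot rcongb}.
HB.instance Definition _ := Choice.on presented.
HB.instance Definition _ := EqQuotient.on presented.

Definition pclass (x : rterm X) : presented := \pi_presented x.

Lemma pclass_eq x y : pclass x = pclass y <-> rcong S x y.
Proof.
split=> [/eqmodP /asboolP //|xy].
by apply/eqmodP; apply/asboolP.
Qed.

Lemma pclass_repr (a : presented) : pclass (repr a) = a.
Proof. exact: reprK. Qed.

Lemma rcong_repr x : rcong S (repr (pclass x)) x.
Proof. by apply/pclass_eq; rewrite pclass_repr. Qed.

Definition pzero : presented := pclass RZero.
Definition popp (a : presented) : presented := pclass (ROpp (repr a)).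
Definition padd (a b : presented) : presented :=
  pclass (RAdd (repr a) (repr b)).
Definition pmul (a b : presented) : presented :=
  pclass (RMul (repr a) (repr b)).

Lemma poppE x : popp (pclass x) = pclass (ROpp x).
Proof. by apply/pclass_eq; apply: rcong_opp; apply: rcong_repr. Qed.

Lemma paddE x y : padd (pclass x) (pclass y) = pclass (RAdd x y).
Proof. by apply/pclass_eq; apply: rcong_add; apply: rcong_repr. Qed.

Lemma pmulE x y : pmul (pclass x) (pclass y) = pclass (RMul x y).
Proof. by apply/pclass_eq; apply: rcong_mul; apply: rcong_repr. Qed.

Lemma paddA : associative padd.
Proof.
move=> a b c; rewrite -(pclass_repr a) -(pclass_repr b) -(pclass_repr c).
by rewrite !paddE; apply/pclass_eq; apply: rcong_addA.
Qed.

Lemma paddC : commutative padd.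
Proof.
move=> a b; rewrite -(pclass_repr a) -(pclass_repr b).
by rewrite !paddE; apply/pclass_eq; apply: rcong_addC.
Qed.

Lemma padd0 : left_id pzero padd.
Proof.
move=> a; rewrite -(pclass_repr a).
by rewrite !paddE; apply/pclass_eq; apply: rcong_add0.
Qed.

Lemma paddN : left_inverse pzero popp padd.
Proof.
move=> a; rewrite -(pclass_repr a).
by rewrite poppE !paddE; apply/pclass_eq; apply: rcong_addN.
Qed.

HB.instance Definition _ :=
  GRing.isZmodule.Build presented paddA paddC padd0 paddN.

Lemma pmulA : associative pmul.
Proof.
move=> a b c; rewrite -(pclass_repr a) -(pclass_repr b) -(pclass_repr c).
by rewrite !pmulE; apply/pclass_eq; apply: rcong_mulA.
Qed.

Lemma pmulDl : left_distributive pmul +%R.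
Proof.
move=> a b c; rewrite -(pclass_repr a) -(pclass_repr b) -(pclass_repr c).
rewrite /GRing.add /= !(paddE, pmulE).
by apply/pclass_eq; apply: rcong_mulDl.
Qed.

Lemma pmulDr : right_distributive pmul +%R.
Proof.
move=> a b c; rewrite -(pclass_repr a) -(pclass_repr b) -(pclass_repr c).
rewrite /GRing.add /= !(paddE, pmulE).
by apply/pclass_eq; apply: rcong_mulDr.
Qed.

End Presentation.

Record graph := Graph {
  VG : choiceType;
  EG : choiceType;
  orig : EG -> VG;
  term : EG -> VG;
  locally_finite : forall v : VG, finite_set [set e : EG | orig e = v]
}.

Section Paths.
Variable G : graph.
Implicit Types (v : VG G) (e : EG G).

Fixpoint is_walk v (s : seq (EG G)) : bool :=
  if s is e :: s' then (orig e == v) && is_walk (term e) s' else true.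

(* A path is stored with its origin, which distinguishes the empty paths at   *)
(* different vertices and is redundant for nonempty ones.                     *)
Record walk := Walk {
  wval : VG G * seq (EG G);
  walkP : is_walk wval.1 wval.2
}.

HB.instance Definition _ := [isSub for wval].
HB.instance Definition _ := [Choice of walk by <:].

Implicit Types p q r : walk.

Definition wO p : VG G := (wval p).1.
Definition wseq p : seq (EG G) := (wval p).2.
Definition wT p : VG G := last (wO p) [seq term e | e <- wseq p].

Definition walks_from v : set walk := [set p | wO p = v].

Definition is_root v : Prop := forall w, exists p, wO p = v /\ wT p = w.

(* q = p r *)
Definition wprefix p q : Prop :=
  exists r, [/\ wO r = wT p, wO q = wO p & wseq q = wseq p ++ wseq r].

Definition independent (B : set walk) : Prop :=
  forall p q, B p -> B q -> wprefix p q -> p = q.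

Definition maximal_basis v (B : set walk) : Prop :=
  [/\ B `<=` walks_from v, independent B &
      forall C : set walk,
        C `<=` walks_from v -> independent C -> B `<=` C -> C = B].

End Paths.

Inductive lpa_gen (G : graph) : Type :=
| GVert of VG G
| GEdge of EG G
| GStar of EG G.

Arguments GVert {G} _.
Arguments GEdge {G} _.
Arguments GStar {G} _.

Section LeavittPathAlgebra.
Variable G : graph.
Implicit Types (v w : VG G) (e : EG G).

Let V v : rterm (lpa_gen G) := RGen (GVert v).
Let E e : rterm (lpa_gen G) := RGen (GEdge e).
Let Es e : rterm (lpa_gen G) := RGen (GStar e).

Inductive lpa_rel : rterm (lpa_gen G) -> rterm (lpa_gen G) -> Prop :=
| lpa_vv v : lpa_rel (RMul (V v) (V v)) (V v)
| lpa_vw v w : v <> w -> lpa_rel (RMul (V v) (V w)) RZero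
| lpa_see' e e' : e <> e' -> lpa_rel (RMul (Es e) (E e')) RZero
| lpa_see e : lpa_rel (RMul (Es e) (E e)) (V (term e))
| lpa_oe e : lpa_rel (RMul (V (orig e)) (E e)) (E e)
| lpa_et e : lpa_rel (RMul (E e) (V (term e))) (E e)
| lpa_tes e : lpa_rel (RMul (V (term e)) (Es e)) (Es e)
| lpa_eso e : lpa_rel (RMul (Es e) (V (orig e))) (Es e)
| lpa_sum v : [set e | orig e = v] !=set0 ->
    lpa_rel (V v)
      (\big[@RAdd _/RZero]_(e <- fset_set [set e | orig e = v])
         RMul (E e) (Es e)).

Definition lpa := presented lpa_rel.
HB.instance Definition _ := GRing.Zmodule.on lpa.

Definition lmul : lpa -> lpa -> lpa := @pmul _ lpa_rel.

Definition lvert v : lpa := pclass lpa_rel (V v).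
Definition ledge e : lpa := pclass lpa_rel (E e).

Fixpoint tstar (x : rterm (lpa_gen G)) : rterm (lpa_gen G) :=
  match x with
  | RGen (GVert v) => V v
  | RGen (GEdge e) => Es e
  | RGen (GStar e) => E e
  | RZero => RZero
  | ROpp y => ROpp (tstar y)
  | RAdd y z => RAdd (tstar y) (tstar z)
  | RMul y z => RMul (tstar z) (tstar y)
  end.

Lemma tstar_cong x y : rcong lpa_rel x y -> rcong lpa_rel (tstar x) (tstar y).
Proof.
elim=> {x y} /=.
- move=> x y []; rewrite /V /E /Es /=; intros.
  + exact/rcong_rel/lpa_vv.
  + by apply/rcong_rel/lpa_vw/nesym.
  + by apply/rcong_rel/lpa_see'/nesym.
  + exact/rcong_rel/lpa_see.
  + exact/rcong_rel/lpa_eso.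
  + exact/rcong_rel/lpa_tes.
  + exact/rcong_rel/lpa_et.
  + exact/rcong_rel/lpa_oe.
  + rewrite (big_morph tstar (id1 := RZero) (op1 := @RAdd _)) //=.
    exact/rcong_rel/lpa_sum.
- by move=> x; apply: rcong_refl.
- by move=> x y _; apply: rcong_sym.
- by move=> y x z _ xy _; apply: rcong_trans.
- by move=> x x' _; apply: rcong_opp.
- by move=> x x' y y' _ xx' _; apply: rcong_add.
- by move=> x x' y y' _ xx' _ yy'; apply: rcong_mul.
- by move=> x y z; apply: rcong_addA.
- by move=> x y; apply: rcong_addC.
- by move=> x; apply: rcong_add0.
- by move=> x; apply: rcong_addN.
- by move=> x y z; apply/rcong_sym/rcong_mulA.
- by move=> x y z; apply: rcong_mulDr.
- by move=> x y z; apply: rcong_mulDl.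
Qed.

Definition lstar (a : lpa) : lpa := pclass lpa_rel (tstar (repr a)).

Lemma lstarE x : lstar (pclass lpa_rel x) = pclass lpa_rel (tstar x).
Proof. by apply/pclass_eq/tstar_cong/rcong_repr. Qed.

Definition lpath (p : walk G) : lpa :=
  if wseq p is e :: s then foldl (fun a e' => lmul a (ledge e')) (ledge e) s
  else lvert (wO p).

Definition Zsubmodule (M : set lpa) : Prop :=
  M 0 /\ forall (k : int) x y, M x -> M y -> M (x *~ k + y).

Definition rooted_lpa (R : VG G) : set lpa :=
  smallest Zsubmodule
    [set x | exists p q, [/\ walks_from R p, walks_from R q, wT p = wT q &
                           x = lmul (lpath p) (lstar (lpath q))]].

Definition unitary_group (R : VG G) : set lpa :=
  [set x | [/\ rooted_lpa R x, lmul x (lstar x) = lvert R &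
                               lmul (lstar x) x = lvert R]].

End LeavittPathAlgebra.

(* Matrices indexed by arbitrary finite sets; both equations together force   *)
(* #|I| = #|J|, as expected of an orthogonal matrix.                          *)
Definition orthogonal_mx (I J : finType) (k : I -> J -> int) : Prop :=
  (forall i i' : I, \sum_(j : J) k i j * k i' j = (i == i')%:R) /\
  (forall j j' : J, \sum_(i : I) k i j * k i j' = (j == j')%:R).

(* Main.v *)
(* The Leavitt path algebra acts on functions on pairs (boundary path, integer),
   an edge prepending itself to the path and raising the integer by one.  A
   diagonal coefficient of this action sends p^* q to 1 if p = q and to 0
   otherwise, for paths p, q with the same origin R and the same end w.  Hence if
   u is a combination sum_p k_p p of such paths and u^* u = w, then
   sum_p k_p^2 = 1: over the integers u is plus or minus a single path.

   Let D be the maximal basis of all paths that have length N or stop earlier at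
   a sink.  For x in the rooted algebra and N large, x d is a combination of
   paths for every d in D, and for unitary x it satisfies (x d)^* (x d) = T(d),
   so x d = +- p_d.  The p_d are pairwise incomparable since x preserves
   p^* q = 0, they form a maximal basis since sum_d p_d p_d^* = x x^* = R, and
   x = sum_d (x d) d^* is given by a signed permutation matrix. *)

Require Import Defs.
From HB Require Import structures.
From mathcomp Require Import all_boot all_order all_algebra.
From mathcomp Require Import finmap boolp classical_sets cardinality.

Set Implicit Arguments.
Unset Strict Implicit.
Unset Printing Implicit Defensive.

Import Order.TTheory GRing.Theory Num.Theory.
Local Open Scope classical_set_scope.
Local Open Scope ring_scope.

(** * Ring laws, the involution, and products of edges along walks *)

Section Algebra.
Variable G : graph.
Implicit Types (v w : VG G) (e : EG G) (a b c : lpa G) (s t : seq (EG G)).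

Lemma lmulA a b c : lmul a (lmul b c) = lmul (lmul a b) c.
Proof. exact: pmulA. Qed.

(** Right multiplication with the fixed factor first, so that it too can be registered as an
    additive map. *)
Definition lmulr b a := lmul a b.

Lemma lmul_zmod_morphism a : zmod_morphism (lmul a).
Proof.
have lmulD x y : lmul a (x + y) = lmul a x + lmul a y by exact: pmulDr.
by move=> x y; apply/eqP; rewrite eq_sym subr_eq -lmulD subrK.
Qed.

Lemma lmulr_zmod_morphism b : zmod_morphism (lmulr b).
Proof.
have lmulD x y : lmulr b (x + y) = lmulr b x + lmulr b y by exact: pmulDl.
by move=> x y; apply/eqP; rewrite eq_sym subr_eq -lmulD subrK.
Qed.

HB.instance Definition _ a :=
  GRing.isZmodMorphism.Build (lpa G) (lpa G) (lmul a) (lmul_zmod_morphism a).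
HB.instance Definition _ b :=
  GRing.isZmodMorphism.Build (lpa G) (lpa G) (lmulr b) (lmulr_zmod_morphism b).

Lemma lmul0l a : lmul 0 a = 0.
Proof. exact: (raddf0 (lmulr a)). Qed.

Lemma lmulDl a b c : lmul (a + b) c = lmul a c + lmul b c.
Proof. exact: (raddfD (lmulr c)). Qed.

Lemma lmulMzl a b (k : int) : lmul (a *~ k) b = lmul a b *~ k.
Proof. exact: (raddfMz (lmulr b)). Qed.

Lemma lmul_suml (I : Type) (r : seq I) (P : pred I) (F : I -> lpa G) a :
  lmul (\sum_(i <- r | P i) F i) a = \sum_(i <- r | P i) lmul (F i) a.
Proof. exact: (raddf_sum (lmulr a)). Qed.

Lemma lstar_zmod_morphism : zmod_morphism (@lstar G).
Proof.
have lstarD x y : lstar (x + y) = lstar x + lstar y.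
  rewrite -(pclass_repr x) -(pclass_repr y).
  rewrite [pclass _ _ + _]paddE !lstarE.
  by rewrite [RHS]paddE.
by move=> x y; apply/eqP; rewrite eq_sym subr_eq -lstarD subrK.
Qed.

HB.instance Definition _ :=
  GRing.isZmodMorphism.Build (lpa G) (lpa G) (@lstar G) lstar_zmod_morphism.

Lemma lstarM a b : lstar (lmul a b) = lmul (lstar b) (lstar a).
Proof.
by rewrite -(pclass_repr a) -(pclass_repr b) /lmul pmulE !lstarE [RHS]pmulE.
Qed.

Lemma lstarK : involutive (@lstar G).
Proof.
move=> a; rewrite -(pclass_repr a) !lstarE; congr pclass.
by elim: (repr a) => [[]||? /= ->|? /= -> ? ->|? /= -> ? ->].
Qed.

Lemma lstar_vert v : lstar (lvert v) = lvert v.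
Proof. exact: lstarE. Qed.

Lemma lvert_idem v : lmul (lvert v) (lvert v) = lvert v.
Proof. by rewrite [LHS]pmulE; apply/pclass_eq/rcong_rel/lpa_vv. Qed.

Lemma lvert_edge e : lmul (lvert (orig e)) (ledge e) = ledge e.
Proof. by rewrite [LHS]pmulE; apply/pclass_eq/rcong_rel/lpa_oe. Qed.

Lemma ledge_vert e : lmul (ledge e) (lvert (term e)) = ledge e.
Proof. by rewrite [LHS]pmulE; apply/pclass_eq/rcong_rel/lpa_et. Qed.

Lemma lstar_edge_edge e : lmul (lstar (ledge e)) (ledge e) = lvert (term e).
Proof.
by rewrite lstarE [LHS]pmulE; apply/pclass_eq/rcong_rel/lpa_see.
Qed.

Lemma lstar_edge_edge0 e e' : e != e' -> lmul (lstar (ledge e)) (ledge e') = 0.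
Proof.
move=> /eqP ee'.
by rewrite lstarE [LHS]pmulE; apply/pclass_eq/rcong_rel/lpa_see'.
Qed.

Definition out v := fset_set [set e | orig e = v].

Lemma mem_out v e : (e \in out v) = (orig e == v).
Proof.
rewrite in_fset_set; last exact: locally_finite.
by apply/idP/eqP => [/set_mem|?]; last apply/mem_set.
Qed.

Lemma lvert_sum v : (exists e, orig e = v) ->
  lvert v = \sum_(e <- out v) lmul (ledge e) (lstar (ledge e)).
Proof.
move=> ev; transitivity (pclass (@lpa_rel G)
  (\big[@RAdd _/RZero]_(e <- out v) RMul (RGen (GEdge e)) (RGen (GStar e)))).
  exact/pclass_eq/rcong_rel/lpa_sum.
rewrite (big_morph (pclass _) (id1 := 0 : lpa G) (op1 := +%R)) //.
  by apply: eq_bigr => e _; rewrite lstarE [RHS]pmulE.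
by move=> x y; rewrite [RHS]paddE.
Qed.

(** A right-nested form of [lpath] that ends in a vertex: it unfolds at the first edge, where the
    cancellation in [p^* q] takes place, and treats empty paths uniformly. *)
Fixpoint wprod v s : lpa G :=
  if s is e :: s' then lmul (ledge e) (wprod (term e) s') else lvert v.

Definition wend v s := last v [seq term e | e <- s].

Lemma is_walk_cat v s t : is_walk v (s ++ t) = is_walk v s && is_walk (wend v s) t.
Proof. by elim: s v => //= e s IH v; rewrite IH andbA. Qed.

Lemma wend_cat v s t : wend v (s ++ t) = wend (wend v s) t.
Proof. by rewrite /wend map_cat last_cat. Qed.

Lemma lvert_wprod v s : is_walk v s -> lmul (lvert v) (wprod v s) = wprod v s.
Proof.
case: s => [|e s] /=; first by rewrite lvert_idem.
by case/andP=> /eqP <- _; rewrite lmulA lvert_edge.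
Qed.

Lemma wprod_cat v s t : is_walk v (s ++ t) ->
  wprod v (s ++ t) = lmul (wprod v s) (wprod (wend v s) t).
Proof.
elim: s v => [|e s IH] v /=; first by move=> /lvert_wprod ->.
by case/andP=> _ /IH ->; rewrite lmulA.
Qed.

Lemma wprod_vert v s : lmul (wprod v s) (lvert (wend v s)) = wprod v s.
Proof.
by elim: s v => [|e s IH] v /=; rewrite ?lvert_idem // -lmulA IH.
Qed.

Lemma lpathE (p : walk G) : lpath p = wprod (wO p) (wseq p).
Proof.
(* [lpath] associates to the left, so the accumulator is generalised to any [a] that absorbs the
   vertex where the rest starts. *)
have foldlE s a v : lmul a (lvert v) = a -> is_walk v s ->
    foldl (fun a e => lmul a (ledge e)) a s = lmul a (wprod v s).
  elim: s a v => [|e s IH] a v //= av /andP[_ es].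
  by rewrite (IH _ (term e)) ?lmulA // -lmulA ledge_vert.
have := walkP p; rewrite /lpath /wO /wseq; case: (wval p).2 => [//|e s] /=.
by case/andP=> _ es; rewrite (foldlE _ _ (term e)) ?ledge_vert.
Qed.

Lemma star_wprod v s : is_walk v s ->
  lmul (lstar (wprod v s)) (wprod v s) = lvert (wend v s).
Proof.
elim: s v => [|e s IH] v /=; first by rewrite lstar_vert lvert_idem.
case/andP=> _ es; rewrite lstarM -lmulA [lmul (lstar _) (lmul (ledge e) _)]lmulA.
by rewrite lstar_edge_edge lvert_wprod // IH.
Qed.

(** Common initial edges cancel in pairs; incomparability ensures that two different edges then
    meet, and their product [e^* e'] is 0. *)
Lemma star_wprod0 v s t : is_walk v s -> is_walk v t ->
  ~~ prefix s t -> ~~ prefix t s -> lmul (lstar (wprod v s)) (wprod v t) = 0.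
Proof.
elim: s v t => [|e s IH] v [|e' t] //= /andP[_ es] /andP[_ et].
rewrite lstarM -lmulA [lmul (lstar (ledge _)) _]lmulA.
have [ee'|ee'] := eqVneq e e'; last first.
  by move=> _ _; rewrite lstar_edge_edge0 // lmul0l raddf0.
rewrite -{}ee' in et *; rewrite lstar_edge_edge /= => st ts.
by rewrite lvert_wprod // IH.
Qed.

End Algebra.

(** * The action on functions of boundary paths, and its diagonal coefficients *)

Section Representation.
Variable G : graph.
Implicit Types (v w : VG G) (e : EG G) (x : lpa G) (s : seq (EG G))
  (t u : rterm (lpa_gen G)).

Definition ray := nat -> VG G * option (EG G).
Definition rfun := ray -> int -> int.
Implicit Types (xi : ray) (f g : rfun) (n d : int).

(* A path that is infinite or ends in a sink, as the sequence of pairs (current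
   vertex, next edge); at a sink it stays there forever with next edge None. *)
Definition boundary xi := forall i,
  match (xi i).2 with
  | Some e => orig e = (xi i).1 /\ (xi i.+1).1 = term e
  | None => (forall e, orig e <> (xi i).1) /\ (xi i.+1).1 = (xi i).1
  end.

Definition rshift xi : ray := fun i => xi i.+1.
Definition rcons_ray e xi : ray :=
  fun i => if i is j.+1 then xi j else (orig e, Some e).

Lemma boundary_shift xi : boundary xi -> boundary (rshift xi).
Proof. by move=> bxi i; apply: bxi. Qed.

Lemma boundary_cons e xi : boundary xi -> (xi 0%N).1 = term e ->
  boundary (rcons_ray e xi).
Proof. by move=> bxi xi0 [|i] //; apply: bxi. Qed.

(** Iterates one fixed choice of an outgoing edge at each vertex that has one, staying put at
    sinks. *)
Lemma boundary_exists v : exists2 xi, boundary xi & (xi 0%N).1 = v.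
Proof.
have /choice[c cP] w : exists o : option (EG G),
    if o is Some e then orig e = w else forall e, orig e <> w.
  have [[e ew]|noe] := pselect (exists e, orig e = w); first by exists (Some e).
  by exists None => e ew; apply: noe; exists e.
pose next w := if c w is Some e then term e else w.
pose xi i := (iter i next v, c (iter i next v)).
exists xi => // i; rewrite /= /next.
by move: (cP (iter i next v)); case: (c _).
Qed.

(** Each generator pulls [f] back along a partial map, so [f] can be any function, with no condition
    on its support. The value 0 off boundary paths replaces a subtype of [ray]. *)
Definition gact (g : lpa_gen G) f : rfun := fun xi n =>
  match g with
  | GVert v => if `[< boundary xi /\ (xi 0%N).1 = v >] then f xi n else 0
  | GEdge e => if `[< boundary xi /\ (xi 0%N).2 = Some e >]
               then f (rshift xi) (n - 1) else 0
  | GStar e => if `[< boundary xi /\ (xi 0%N).1 = term e >]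
               then f (rcons_ray e xi) (n + 1) else 0
  end.

Fixpoint tact (t : rterm (lpa_gen G)) f : rfun :=
  match t with
  | RGen g => gact g f
  | RZero => fun _ _ => 0
  | ROpp t => fun xi n => - tact t f xi n
  | RAdd t u => fun xi n => tact t f xi n + tact u f xi n
  | RMul t u => tact t (tact u f)
  end.

(** Gives right distributivity, the one ring axiom that does not follow pointwise from the
    definition of [tact]. *)
Lemma tactD t f g : tact t (fun xi n => f xi n + g xi n) =
  (fun xi n => tact t f xi n + tact t g xi n).
Proof.
elim: t f g => [a||t IH|t IHt u IHu|t IHt u IHu] f g /=.
- by apply/funext => xi; apply/funext => n; case: a => ? /=; case: ifP;
    rewrite ?addr0.
- by apply/funext => xi; apply/funext => n; rewrite addr0.
- by rewrite IH; apply/funext => xi; apply/funext => n; rewrite opprD.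
- by rewrite IHt IHu; apply/funext => xi; apply/funext => n; rewrite addrACA.
- by rewrite IHu IHt.
Qed.

Lemma tact_rel t u : lpa_rel t u -> tact t = tact u.
Proof.
case=> {t u} [v|v w vw|e e' ee'|e|e|e|e|e|v [e0 e0v]];
  apply/funext => f; apply/funext => xi; apply/funext => n /=.
- by case: asboolP.
- case: asboolP => // -[_ xiv]; case: asboolP => // -[_ xiw].
  by case: vw; rewrite -xiv.
- case: asboolP => // -[bxi xi0]; case: asboolP => // -[_ [ee'']].
  by case: ee'.
- case: asboolP => // -[bxi xi0]; case: asboolP => [_|]; first by rewrite addrK.
  by case; split=> //; apply: boundary_cons.
- case: asboolP => [//|noe]; case: asboolP => // -[bxi xi0]; case: noe; split=> //.
  by have := bxi 0%N; rewrite xi0 => -[].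
- case: asboolP => // -[bxi xi0]; case: asboolP => // -[].
  split; first exact: boundary_shift.
  by have := bxi 0%N; rewrite xi0 => -[].
- by case: asboolP.
- case: asboolP => // -[bxi xi0]; case: asboolP => // -[].
  by split=> //; apply: boundary_cons.
- set r := fset_set _; have memr e : (e \in r) = (orig e == v) by exact: mem_out.
  have -> (F : EG G -> rterm (lpa_gen G)) :
      tact (\big[@RAdd _/RZero]_(e <- r) F e) f xi n = \sum_(e <- r) tact (F e) f xi n.
    exact: (big_morph (fun t => tact t f xi n) (id1 := 0) (op1 := +%R)).
  case: asboolP => [[bxi xi0]|nxi]; last first.
    rewrite big_seq big1 // => e; rewrite memr => /eqP ev /=.
    case: asboolP => // -[bxi xi0]; case: nxi; split=> //.
    by have := bxi 0%N; rewrite xi0 ev => -[].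
  (* Since [e0] leaves [v], the path [xi] does not stop there, and its first edge selects the only
     summand that can be nonzero. *)
  have := bxi 0%N; case xie: (xi 0%N).2 => [e|]; last first.
    by case=> noe; case: (noe e0); rewrite xi0.
  case=> ev xi1; rewrite (bigD1_seq e) ?memr ?ev ?xi0 ?fset_uniq //= big1.
    rewrite addr0 subrK asboolT // asboolT; last first.
      by split=> //; apply: boundary_shift.
    (* Deleting the first edge and prepending it again gives back [xi]. *)
    congr f; apply/funext => -[|i] //=.
    by rewrite [LHS]surjective_pairing xie -ev.
  by move=> e' e'e; case: asboolP => // -[_]; rewrite xie => -[ee'];
    rewrite ee' eqxx in e'e.
Qed.

Lemma tact_cong t u : rcong (@lpa_rel G) t u -> tact t = tact u.
Proof.
elim=> {t u} /=.
- exact: tact_rel.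
- by [].
- by move=> t u _ ->.
- by move=> u t z _ -> _ ->.
- by move=> t t' _ ->.
- by move=> t t' u u' _ -> _ ->.
- by move=> t t' u u' _ -> _ ->.
- by move=> t u z; do 3!apply/funext => ?; rewrite addrA.
- by move=> t u; do 3!apply/funext => ?; rewrite addrC.
- by move=> t; do 3!apply/funext => ?; rewrite add0r.
- by move=> t; do 3!apply/funext => ?; rewrite addNr.
- by [].
- by [].
- by move=> t u z; apply/funext => f; rewrite tactD.
Qed.

Definition lact (x : lpa G) := tact (repr x).

Lemma lactE t : lact (pclass _ t) = tact t.
Proof. exact/tact_cong/rcong_repr. Qed.

Lemma lactM x y f : lact (lmul x y) f = lact x (lact y f).
Proof. by rewrite /lmul /pmul lactE. Qed.

Lemma lact_zmod_morphism f xi n : zmod_morphism (fun x => lact x f xi n).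
Proof.
have lactD x y : lact (x + y) f xi n = lact x f xi n + lact y f xi n.
  by rewrite [x + y]/(padd x y) /padd lactE.
by move=> x y /=; apply/eqP; rewrite eq_sym subr_eq -lactD subrK.
Qed.

(** Concentration in degree [d]; edges raise the degree by one and their stars lower it, so degrees
    record path lengths. *)
Definition homog d f := forall xi n, n != d -> f xi n = 0.

Lemma homog_edge e d f : homog d f -> homog (d + 1) (lact (ledge e) f).
Proof.
move=> hf xi n nd; rewrite lactE /=; case: ifP => // _.
by rewrite hf // subr_eq.
Qed.

Lemma homog_edge_star e d f : homog d f -> homog (d - 1) (lact (lstar (ledge e)) f).
Proof.
move=> hf xi n nd; rewrite lstarE lactE /=; case: ifP => // _.
by rewrite hf // -[d](subrK 1) (inj_eq (addIr 1)).
Qed.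

Lemma homog_vert v d f : homog d f -> homog d (lact (lvert v) f).
Proof. by move=> hf xi n nd; rewrite lactE /= hf //; case: ifP. Qed.

Lemma homog_wprod v s d f :
  homog d f -> homog (d + (size s)%:Z) (lact (wprod v s) f).
Proof.
move=> hf; elim: s v => [|e s IH] v /=; first by rewrite addr0; apply: homog_vert.
by rewrite lactM -addn1 PoszD addrA; apply/homog_edge/IH.
Qed.

Lemma homog_wprod_star v s d f :
  homog d f -> homog (d - (size s)%:Z) (lact (lstar (wprod v s)) f).
Proof.
elim: s v d f => [|e s IH] v d f hf /=.
  by rewrite subr0 lstar_vert; apply: homog_vert.
by rewrite lstarM lactM -addn1 PoszD opprD addrA addrAC; apply/IH/homog_edge_star.
Qed.

Definition some_ray w : ray := projT1 (cid2 (boundary_exists w)).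

Definition ray_delta w : rfun :=
  fun xi n => if `[< xi = some_ray w >] && (n == 0) then 1 else 0.

Definition vtrace w x : int := lact x (ray_delta w) (some_ray w) 0.

HB.instance Definition _ w := GRing.isZmodMorphism.Build (lpa G) int (vtrace w)
  (lact_zmod_morphism (ray_delta w) (some_ray w) 0).

Lemma vtrace_vert w : vtrace w (lvert w) = 1.
Proof.
rewrite /vtrace lactE /=.
have [bxi xi0] : boundary (some_ray w) /\ (some_ray w 0%N).1 = w.
  by rewrite /some_ray; case: cid2.
by rewrite asboolT // /ray_delta asboolT.
Qed.

(** Rules out a collapse of the presented ring: the action detects every vertex. *)
Lemma lvert_neq0 w : lvert w != 0.
Proof. by apply/eqP => w0; have := vtrace_vert w; rewrite w0 raddf0. Qed.

(** Distinct paths of equal length are incomparable, so the product is 0. For different lengths it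
    moves degree 0 to a nonzero degree; without degrees, a product [p^* q] that fixes a periodic
    boundary path would show up on the diagonal. *)
Lemma vtrace_star_wprod v s s' : is_walk v s -> is_walk v s' ->
  vtrace (wend v s) (lmul (lstar (wprod v s)) (wprod v s')) = (s == s')%:R.
Proof.
move=> vs vs'; have [->|st] := eqVneq s s'; first by rewrite star_wprod // vtrace_vert.
have [size_st|size_st] := eqVneq (size s) (size s').
  by rewrite star_wprod0 ?raddf0 // prefixE ?size_st ?take_size
    -1?size_st ?take_size // eq_sym.
rewrite /vtrace lactM.
have := @homog_wprod_star v s (0 + (size s')%:Z) _ (@homog_wprod v s' 0 (ray_delta _) _).
apply; first by move=> xi n /negPf n0; rewrite /ray_delta n0 andbF.
by rewrite add0r eq_sym subr_eq0 eqz_nat eq_sym.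
Qed.

End Representation.

(** * Comparability of paths, and maximal bases *)

Section Bases.
Variables (G : graph) (R : VG G).
Implicit Types (p q r : walk G) (B : {fset walk G}) (s : seq (EG G)).

Definition mkwalk v s (vs : is_walk v s) : walk G := @Walk G (v, s) vs.

Lemma wseq_mkwalk v s (vs : is_walk v s) : wseq (mkwalk vs) = s.
Proof. by []. Qed.

Lemma walk_eq p q : wO p = wO q -> wseq p = wseq q -> p = q.
Proof.
rewrite /wO /wseq => pq1 pq2; apply: val_inj.
by rewrite [LHS]surjective_pairing [RHS]surjective_pairing pq1 pq2.
Qed.

Lemma wprefixE p q : wprefix p q <-> wO p = wO q /\ prefix (wseq p) (wseq q).
Proof.
split=> [[r [_ qp qpr]]|[pq /prefixP[s qps]]]; first by rewrite qp qpr prefix_prefix.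
have /= : is_walk (wO q) (wseq q) := walkP q.
rewrite qps is_walk_cat => /andP[_ ws].
by rewrite -pq in ws; exists (mkwalk ws).
Qed.

Lemma wprefix_refl p : wprefix p p.
Proof. by apply/wprefixE; rewrite prefix_refl. Qed.

Lemma star_lpath p : lmul (lstar (lpath p)) (lpath p) = lvert (wT p).
Proof. by rewrite lpathE star_wprod //; apply: walkP. Qed.

Lemma star_lpath0 p q : wO p = wO q -> ~ wprefix p q -> ~ wprefix q p ->
  lmul (lstar (lpath p)) (lpath q) = 0.
Proof.
move=> pq npq nqp; rewrite !lpathE -pq star_wprod0 //; first exact: walkP.
- by rewrite pq; apply: walkP.
- by apply/negP => pr; apply/npq/wprefixE.
- by apply/negP => pr; apply/nqp/wprefixE.
Qed.

Lemma star_lpath_indep (B : set (walk G)) p q :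
  B `<=` walks_from R -> independent B -> B p -> B q ->
  lmul (lstar (lpath p)) (lpath q) = if p == q then lvert (wT p) else 0.
Proof.
move=> BR indB Bp Bq; case: eqVneq => [<-|/eqP pq]; first exact: star_lpath.
apply: star_lpath0; first by rewrite (BR _ Bp) (BR _ Bq).
- by move=> /(indB _ _ Bp Bq).
- by move=> /(indB _ _ Bq Bp)/esym.
Qed.

Lemma star_lpath_cat p q s : wO p = wO q -> wseq q = wseq p ++ s ->
  [/\ is_walk (wT p) s, wT q = wend (wT p) s &
      lmul (lstar (lpath p)) (lpath q) = wprod (wT p) s].
Proof.
move=> pq qps; have := walkP q; rewrite -/(wseq q) -/(wO q) qps => qw.
have := qw; rewrite is_walk_cat -pq => /andP[pw sw]; split=> //.
  by rewrite -[wT q]/(wend (wO q) (wseq q)) qps wend_cat -pq.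
by rewrite !lpathE qps wprod_cat // -pq lmulA star_wprod // lvert_wprod.
Qed.

(** The product is the remaining path [s], and [s^* s] is a vertex, hence nonzero. *)
Lemma star_lpath_neq0 p q : wprefix p q -> lmul (lstar (lpath p)) (lpath q) != 0.
Proof.
case/wprefixE=> pq /prefixP[s qps]; have [sw _ ->] := star_lpath_cat pq qps.
apply/eqP => s0; have := lvert_neq0 (wend (wT p) s).
by rewrite -star_wprod // s0 raddf0 eqxx.
Qed.

Lemma lpath_vert p : lmul (lpath p) (lvert (wT p)) = lpath p.
Proof. by rewrite lpathE wprod_vert. Qed.

Lemma lvert_lpath p : lmul (lvert (wO p)) (lpath p) = lpath p.
Proof. by rewrite lpathE lvert_wprod //; apply: walkP. Qed.

(** A path incomparable with all of [B] could be adjoined to it; conversely, a path comparable with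
    some [b] in [B] lies in an independent superset only if it equals [b]. *)
Lemma maximal_basisP (B : set (walk G)) : maximal_basis R B <->
  [/\ B `<=` walks_from R, independent B & forall p, wO p = R ->
      exists2 b, B b & wprefix p b \/ wprefix b p].
Proof.
split=> -[BR indB maxB]; split=> //.
- move=> p pR; apply: contrapT => np.
  have npB b : B b -> ~ wprefix p b /\ ~ wprefix b p.
    by move=> Bb; split=> pb; apply: np; exists b => //; [left|right].
  have Bp : B p.
    rewrite -(maxB (B `|` [set p])); last by left.
    + by right.
    + by move=> q [/BR|->].
    + move=> q r [Bq|->] [Br|->] //; first exact: indB.
      * by case: (npB _ Bq).
      * by case: (npB _ Br).
  by have [] := npB p Bp; rewrite /not; have := wprefix_refl p; tauto.
- move=> C CR indC BC; apply/seteqP; split=> // c Cc.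
  have [b Bb [cb|bc]] := maxB c (CR _ Cc); first by rewrite (indC c b) //; apply: BC.
  by rewrite -(indC b c) //; apply: BC.
Qed.

(** For a prefix [s] of some basis element, [s s^*] is the sum of [b b^*] over the [b] that extend
    [s]. If [s] is not in [B], the relation at its end vertex splits [s s^*] over its one-edge
    extensions, and induction moves towards the longest elements of [B]. The empty [s] gives the
    claim. *)
Lemma lvert_basis_sum B : maximal_basis R [set` B] ->
  lvert R = \sum_(b <- B) lmul (lpath b) (lstar (lpath b)).
Proof.
move=> /maximal_basisP[BR indB maxB].
pose n := \max_(b <- B) size (wseq b).
have sizeB b : b \in B -> (size (wseq b) <= n)%N.
  by move=> Bb; rewrite /n (big_fsetD1 b) //= leq_maxl.
suff sum_prefix s : is_walk R s -> (exists2 b, b \in B & prefix s (wseq b)) ->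
    lmul (wprod R s) (lstar (wprod R s)) =
    \sum_(b <- B | prefix s (wseq b)) lmul (lpath b) (lstar (lpath b)).
  have := sum_prefix [::] isT; rewrite /= lstar_vert lvert_idem => ->.
    by apply: eq_bigl => b; rewrite prefix0s.
  have [b Bb _] := maxB (@mkwalk R [::] isT) erefl.
  by exists b => //; rewrite prefix0s.
have [m] := ubnP (n - size s)%N; elim: m s => // m IH s sm ws [b0 Bb0 sb0].
pose p := mkwalk ws.
have [Bp|nBp] := boolP (p \in B).
  rewrite big_mkcond (bigD1_seq p) ?fset_uniq //= prefix_refl big1_seq.
    by rewrite addr0 lpathE.
  move=> b /andP[/eqP bp Bb]; case: ifP => // sb; case: bp; apply/esym/indB => //.
  by apply/wprefixE; rewrite (BR _ Bb).
have proper b : b \in B -> prefix s (wseq b) ->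
    exists e (r : seq (EG G)), orig e = wend R s /\ wseq b = s ++ e :: r.
  move=> Bb /prefixP[[|e r] bs].
    case/negP: nBp; suff -> : p = b by [].
    by apply: walk_eq; rewrite ?(BR _ Bb) // bs cats0.
  exists e, r; split=> //; have := walkP b; rewrite -/(wseq b) -/(wO b) bs (BR _ Bb).
  by rewrite is_walk_cat => /andP[_ /andP[/eqP]].
have [e0 [r0 [e0s b0s]]] := proper _ Bb0 sb0.
have wsplit e : orig e = wend R s -> is_walk R (s ++ [:: e]).
  by move=> es; rewrite is_walk_cat ws /= es eqxx.
transitivity (\sum_(e <- out (wend R s))
    lmul (wprod R (s ++ [:: e])) (lstar (wprod R (s ++ [:: e])))).
  rewrite -[X in lmul X _]wprod_vert lvert_sum; last by exists e0.
  rewrite raddf_sum lmul_suml; apply: eq_big_seq => e.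
  rewrite mem_out => /eqP es; rewrite wprod_cat ?wsplit //= ledge_vert lstarM.
  by rewrite !lmulA.
transitivity (\sum_(e <- out (wend R s)) \sum_(b <- B | prefix (s ++ [:: e]) (wseq b))
    lmul (lpath b) (lstar (lpath b))).
  apply: eq_big_seq => e; rewrite mem_out => /eqP es; apply: IH (wsplit _ es) _.
    rewrite size_cat addn1 -ltnS (leq_trans _ sm) // ltnS ltn_sub2l //.
    (* The truncated difference [n - size s] drops only if [size s < n], which holds because [b0] is
       longer than [s]. *)
    by apply: leq_trans (sizeB _ Bb0); rewrite b0s size_cat /= addnS ltnS leq_addr.
  (* By maximality some [b] is comparable with the extension. It cannot be a prefix of [s]: it would
     then be a prefix of [b0], hence equal to [b0], which is longer than [s]. *)
  have [b Bb bp] := maxB (mkwalk (wsplit e es)) erefl.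
  exists b => //; case: bp => /wprefixE[_]; rewrite wseq_mkwalk // => /prefixP[r] qbr.
  case/lastP: r qbr => [|r x]; first by rewrite cats0 => ->; apply: prefix_refl.
  rewrite -rcons_cat cats1 => /rcons_inj[sbr _].
  have bb0 : b = b0.
    apply: indB => //; apply/wprefixE; rewrite (BR _ Bb) (BR _ Bb0); split=> //.
    by rewrite b0s sbr -catA prefix_prefix.
  move: (congr1 size b0s); rewrite sbr bb0 !size_cat /= -addnA => /eqP.
  by rewrite -[X in X == _]addn0 eqn_add2l addnS.
rewrite (exchange_big_dep (fun b => prefix s (wseq b))) /=; last first.
  by move=> e b _; apply: catl_prefix.
rewrite big_seq_cond [RHS]big_seq_cond; apply: eq_bigr => b /andP[Bb sb].
have [e [r [es bs]]] := proper _ Bb sb.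
(* Only the edge that follows [s] in [b] contributes. *)
rewrite big_mkcond (bigD1_seq e) ?mem_out ?es ?eqxx ?fset_uniq //=.
rewrite bs prefix_catr //= !eqxx prefix0s /= big1 ?addr0 // => e' e'e.
by rewrite prefix_catr //= (negPf e'e) andbF.
Qed.
End Bases.

(** * Truncations of the unfolding tree, and integer combinations of paths with a common end *)

Section Levels.
Variables (G : graph) (R : VG G).
Implicit Types (p q r b : walk G) (s : seq (EG G)) (v w : VG G) (x u : lpa G).

Definition sink v := forall e : EG G, orig e <> v.

Definition level N : set (walk G) :=
  [set p | wO p = R /\ (size (wseq p) = N \/ (size (wseq p) <= N)%N /\ sink (wT p))].

Lemma finite_short_walks v N :
  finite_set [set s : seq (EG G) | is_walk v s /\ (size s <= N)%N].
Proof.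
elim: N v => [|N IH] v.
  by apply: (sub_finite_set _ (finite_set1 [::])) => s /= [_]; case: s.
apply: (@sub_finite_set _ _ ([set [::]] `|` \bigcup_(e in [set e | orig e = v])
    [set e :: s | s in [set s | is_walk (term e) s /\ (size s <= N)%N]])).
  move=> [|e s] /=; first by left.
  by case=> /andP[/eqP ev es] sN; right; exists e => //; exists s.
rewrite finite_setU; split; first exact: finite_set1.
by apply: bigcup_finite => [|e _]; [exact: locally_finite|exact: finite_image].
Qed.

Lemma finite_level N : finite_set (level N).
Proof.
(* The level lies in the image of a finite set of edge sequences; the empty path at [R] is a mere
   default for sequences that are not walks. *)
pose f s : walk G := insubd (@mkwalk G R [::] isT) (R, s).
apply: (sub_finite_set _ (finite_image f (finite_short_walks R N))) => p [pR pN].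
have wp : is_walk R (wseq p) by rewrite -pR; apply: walkP.
exists (wseq p); first by split=> //; case: pN => [->|[]].
by apply: val_inj; rewrite /f val_insubd /= wp -pR -surjective_pairing.
Qed.

Lemma wprefix_sink p q : sink (wT p) -> wprefix p q -> q = p.
Proof.
move=> sp [r [rp qp qps]]; apply: walk_eq => //; rewrite qps.
have := walkP r; rewrite -/(wO r) -/(wseq r) rp.
case: (wseq r) => [|e s] /=; first by rewrite cats0.
by case/andP=> /eqP /sp.
Qed.

Lemma walk_extend N p : (size (wseq p) <= N)%N -> 
  exists q, wprefix p q /\ (size (wseq q) = N \/ (size (wseq q) <= N)%N /\ sink (wT q)).
Proof.
have [m] := ubnP (N - size (wseq p))%N; elim: m p => // m IH p pm pN.
have [sp|nsp] := pselect (sink (wT p)).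
  by exists p; split; [exact: wprefix_refl|right].
have [pN'|pN'] := eqVneq (size (wseq p)) N.
  by exists p; split; [exact: wprefix_refl|left].
have [e es] : exists e, orig e = wT p.
  by apply: contrapT => ne; apply: nsp => e ep; apply: ne; exists e.
have wpe : is_walk (wO p) (wseq p ++ [:: e]).
  by rewrite is_walk_cat /= es eqxx (walkP p : is_walk (wO p) (wseq p)).
have pe_le : ((size (wseq p)).+1 <= N)%N by rewrite ltn_neqAle pN'.
have [] := IH (mkwalk wpe); rewrite ?wseq_mkwalk ?size_cat ?addn1 //.
  by rewrite -ltnS (leq_trans _ pm) // ltnS ltn_sub2l.
move=> q [peq qN]; exists q; split=> //.
have [pq] := (wprefixE _ _).1 peq; rewrite wseq_mkwalk => /catl_prefix ppq.
by apply/wprefixE; rewrite -pq.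
Qed.

(** No element has a proper extension in the level: it has full length or ends in a sink. A path of
    length at most [N] can be prolonged into the level, and a longer one is cut after [N] edges. *)
Lemma level_maximal_basis N : maximal_basis R (level N).
Proof.
apply/maximal_basisP; split=> [p []//|p q [pR pN] [qR qN] pq|p pR].
  case: pN => [pN|[_ sp]]; last by rewrite (wprefix_sink sp pq).
  have [_ /prefixP[s qps]] := (wprefixE p q).1 pq.
  apply: walk_eq; first by rewrite pR.
  have : (size (wseq q) <= N)%N by case: qN => [->|[]].
  rewrite qps size_cat pN -[X in (_ <= X)%N]addn0 leq_add2l leqn0.
  by move=> /nilP ->; rewrite cats0.
have [pN|Np] := leqP (size (wseq p)) N.
  have [q [pq qN]] := walk_extend pN; exists q; last by left.
  by split=> //; have [<-] := (wprefixE p q).1 pq.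
have := walkP p; rewrite -/(wO p) -/(wseq p) pR -(cat_take_drop N (wseq p)).
rewrite is_walk_cat => /andP[wt _]; exists (mkwalk wt).
  by split=> //; left; rewrite size_take Np.
by right; apply/wprefixE; rewrite pR prefix_take.
Qed.

Definition path_comb w : set (lpa G) :=
  [set u | exists (P : {fset walk G}) (k : walk G -> int),
    (forall p, p \in P -> wO p = R /\ wT p = w) /\
    u = \sum_(p <- P) lpath p *~ k p].

Lemma path_comb_Zsubmodule w : Zsubmodule (path_comb w).
Proof.
split=> [|c x y [P [k [PR ->]]] [Q [l [QR ->]]]].
  by exists fset0, (fun=> 0); rewrite big_seq_fset0.
(* Each coefficient function is reset to 0 off its own support before the two are combined over the
   union. *)
exists (P `|` Q)%fset, (fun p => (if p \in P then k p else 0) * c +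
  (if p \in Q then l p else 0)); split.
  by move=> p; rewrite in_fsetU => /orP[/PR|/QR].
under [RHS]eq_bigr => p _ do rewrite mulrzDr mulrzA.
rewrite big_split /= -mulrz_suml; congr (_ *~ c + _).
  rewrite -(big_fset_incl _ (fsubsetUl P Q)) => [|p _ /negPf ->]; last exact: mulr0z.
  by apply: eq_big_seq => p ->.
rewrite -(big_fset_incl _ (fsubsetUr P Q)) => [|p _ /negPf ->]; last exact: mulr0z.
by apply: eq_big_seq => p ->.
Qed.

Lemma path_comb_lpath p : wO p = R -> path_comb (wT p) (lpath p).
Proof.
move=> pR; exists [fset p]%fset, (fun=> 1); split; last by rewrite big_seq_fset1.
by move=> q /fset1P ->.
Qed.

Lemma rooted_lpa_Zsubmodule : Zsubmodule (rooted_lpa R).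
Proof.
split=> [M [[M0 _] _] //|k x y Mx My M MP].
by apply: MP.1.2; [apply: Mx|apply: My].
Qed.

Lemma rooted_lpa_mulR x : rooted_lpa R x -> lmul x (lvert R) = x.
Proof.
move: x; apply: smallest_sub.
  by split=> [|k x y /= xR yR]; rewrite ?lmul0l // lmulDl lmulMzl xR yR.
move=> _ [p [q [pR qR pq ->]]] /=.
by rewrite -lmulA -(lstar_vert R) -lstarM -qR lvert_lpath.
Qed.

(** For a generator [p q^*] take [N] to be the length of [q]. Then [b] is not a proper prefix of
    [q], so either [q] is a prefix of [b] and [p q^* b] is a path, or the product is 0. *)
Lemma rooted_lpa_mul_path x : rooted_lpa R x -> exists N, forall b, wO b = R ->
  (N <= size (wseq b))%N \/ sink (wT b) -> path_comb (wT b) (lmul x (lpath b)).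
Proof.
move: x; apply: smallest_sub.
  split=> [|k x y /= [M xM] [N yN]].
    by exists 0%N => b _ _; rewrite lmul0l; case: (path_comb_Zsubmodule (wT b)).
  exists (maxn M N) => b bR bMN; rewrite lmulDl lmulMzl.
  apply: (path_comb_Zsubmodule (wT b)).2; [apply: xM|apply: yN] => //;
    case: bMN => [|]; [rewrite geq_max => /andP[? ?]; left| right|
    rewrite geq_max => /andP[? ?]; left|right] => //.
move=> _ [p [q [pR qR pq ->]]]; exists (size (wseq q)) => b bR bq.
rewrite -lmulA; have [qb|nqb] := pselect (wprefix q b).
  have [_ /prefixP[s bs]] := (wprefixE q b).1 qb.
  have [sw -> ->] := star_lpath_cat (etrans qR (esym bR)) bs; rewrite -pq in sw *.
  have psw : is_walk (wO p) (wseq p ++ s).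
    by rewrite is_walk_cat (walkP p : is_walk (wO p) (wseq p)).
  rewrite lpathE -wprod_cat // -wend_cat.
  have -> : wprod (wO p) (wseq p ++ s) = lpath (mkwalk psw) by rewrite lpathE.
  exact: (@path_comb_lpath (mkwalk psw)).
rewrite star_lpath0 ?qR //; first by rewrite raddf0; case: (path_comb_Zsubmodule (wT b)).
move=> bq'; apply: nqb; suff <- : b = q by apply: wprefix_refl.
case: bq => [qb|sb]; last by rewrite (wprefix_sink sb bq').
have [_ /prefixP[s qs]] := (wprefixE b q).1 bq'.
apply: walk_eq; first by rewrite bR.
move: qb; rewrite qs size_cat -[X in (_ <= X)%N]addn0 leq_add2l leqn0 => /nilP ->.
by rewrite cats0.
Qed.

(** A nonzero integer has square at least 1, so a single one exhausts the sum. This is where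
    integrality enters. *)
Lemma sum_sqr_eq1 (I : finType) (k : I -> int) : \sum_i k i * k i = 1 ->
  exists2 i, k i * k i = 1 & forall j, j != i -> k j = 0.
Proof.
move=> k1; have k_ge0 i : 0 <= k i * k i by rewrite -expr2 sqr_ge0.
have [i ki|k0] := pickP (fun i => k i != 0); last first.
  by move: k1; rewrite big1 // => i _; move/eqP: (k0 i) => ->.
have ki1 : 1 <= k i * k i by rewrite -gtz0_ge1 lt0r k_ge0 mulf_neq0.
move: k1; rewrite (bigD1 i) //= => k1.
have s_ge0 : 0 <= \sum_(j | j != i) k j * k j by apply: sumr_ge0.
have s0 : \sum_(j | j != i) k j * k j = 0.
  by apply/eqP; rewrite eq_le s_ge0 andbT -(lerD2l (k i * k i)) k1 addr0.
exists i; first by rewrite -k1 s0 addr0.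
by move=> j ji; have /eqP := psumr_eq0P (fun j _ => k_ge0 j) s0 ji;
  rewrite mulf_eq0 orbb => /eqP.
Qed.

(** For [vtrace w] the paths from [R] to [w] are orthonormal, so [u^* u = w] yields a sum of squares
    equal to 1. *)
Lemma path_comb_isometry w u : path_comb w u -> lmul (lstar u) u = lvert w ->
  exists p (k : int), [/\ wO p = R, wT p = w, k * k = 1 & u = lpath p *~ k].
Proof.
move=> [P [k [PR ->]]] uu.
have trE p q : p \in P -> q \in P ->
    vtrace w (lmul (lstar (lpath p)) (lpath q)) = (p == q)%:R.
  move=> /PR[pR <-] /PR[qR _]; rewrite !lpathE pR qR.
  rewrite -[wT p]/(wend (wO p) (wseq p)) pR vtrace_star_wprod; last first.
  - by rewrite -qR; apply: walkP.
  - by rewrite -pR; apply: walkP.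
  congr (nat_of_bool _)%:R; apply/eqP/eqP => [|->] // pq.
  by apply: walk_eq; rewrite ?pR ?qR.
have sumk : \sum_(p : P) k (val p) * k (val p) = 1.
  rewrite -(vtrace_vert w) -uu (raddf_sum (@lstar G)) lmul_suml (raddf_sum (vtrace w)).
  rewrite big_seq_fsetE /=.
  apply: eq_bigr => p _; rewrite (raddfMz (@lstar G)) lmulMzl (raddfMz (vtrace w)).
  rewrite (raddf_sum (lmul _)) (raddf_sum (vtrace w)) big_seq_fsetE (bigD1 p) //=.
  rewrite big1 => [|q qp].
    rewrite (raddfMz (lmul _)) (raddfMz (vtrace w)) /= trE ?valP //.
    by rewrite eqxx addr0 !mulrzz mul1r.
  rewrite (raddfMz (lmul _)) (raddfMz (vtrace w)) /= trE ?valP //.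
  by rewrite eq_sym (inj_eq val_inj) (negPf qp) mul0rz.
have [p kp k0] := sum_sqr_eq1 sumk.
have [pR pw] := PR _ (valP p); exists (val p), (k (val p)); split=> //.
rewrite big_seq_fsetE (bigD1 p) //= big1 ?addr0 // => q qp.
by rewrite k0 ?mulr0z.
Qed.

End Levels.

(** * Elements given by a matrix over two bases, and the shape of unitary elements *)

Section Unitaries.
Variables (G : graph) (R : VG G).
Implicit Types (p q : walk G) (x : lpa G).

Definition basis_mx (B B' : {fset walk G}) (k : B -> B' -> int) : lpa G :=
  \sum_(b : B) \sum_(b' : B')
    lmul (lpath (val b)) (lstar (lpath (val b'))) *~ k b b'.

(** The involution transposes the matrix, so [x^* x] can be computed like [x x^*] with the bases
    exchanged. *)
Lemma lstar_basis_mx (B B' : {fset walk G}) (k : B -> B' -> int) :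
  lstar (basis_mx k) = basis_mx (fun b' b => k b b').
Proof.
rewrite /basis_mx (raddf_sum (@lstar G)) exchange_big; apply: eq_bigr => b _.
rewrite raddf_sum; apply: eq_bigr => b' _.
by rewrite raddfMz /= lstarM lstarK.
Qed.

Lemma basis_mx_star (B B' : {fset walk G}) (k : B -> B' -> int) :
  maximal_basis R [set` B] -> maximal_basis R [set` B'] ->
  (forall b c, \sum_(b' : B') k b b' * k c b' = (b == c)%:R) ->
  (forall b b', wT (val b) <> wT (val b') -> k b b' = 0) ->
  lmul (basis_mx k) (lstar (basis_mx k)) = lvert R.
Proof.
move=> maxB [B'R indB' _] kk kT; pose row b := \sum_b' lstar (lpath (val b')) *~ k b b'.
have rowE : basis_mx k = \sum_b lmul (lpath (val b)) (row b).
  apply: eq_bigr => b _; rewrite raddf_sum; apply: eq_bigr => b' _ /=.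
  by rewrite (raddfMz (lmul _)).
(* Independence of [B'] leaves only vertices [T(b')] in the product of two rows. The path [b] on the
   left absorbs them: the coefficient vanishes unless [T(b) = T(b')]. *)
have row_row b c : lmul (lmul (lpath (val b)) (row b)) (lstar (row c)) =
    lpath (val b) *~ (b == c)%:R.
  rewrite -kk mulrz_sumr /row (raddf_sum (lmul _)) lmul_suml.
  apply: eq_bigr => b' _; rewrite (raddfMz (lmul _)) lmulMzl /=.
  rewrite (raddf_sum (@lstar G)) (raddf_sum (lmul _)) (bigD1 b') //= big1 => [|c' c'b'].
    rewrite addr0 (raddfMz (@lstar G)) /= lstarK (raddfMz (lmul _)) /= -lmulA.
    rewrite star_lpath -mulrzA mulrC.
    have [bb'|/kT ->] := pselect (wT (val b) = wT (val b')); last first.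
      by rewrite mul0r !mulr0z.
    by rewrite -bb' lpath_vert.
  rewrite (raddfMz (@lstar G)) /= lstarK (raddfMz (lmul _)) /= -lmulA.
  rewrite (star_lpath_indep B'R indB' (valP b') (valP c')).
  by rewrite eq_sym (inj_eq val_inj) (negPf c'b') raddf0 mul0rz.
rewrite {2}rowE (raddf_sum (@lstar G)) rowE (raddf_sum (lmul _)) /=.
rewrite (lvert_basis_sum maxB) big_seq_fsetE; apply: eq_bigr => c _ /=.
rewrite lmul_suml (bigD1 c) //= big1 ?addr0 => [|b bc].
  by rewrite lstarM lmulA row_row eqxx.
by rewrite lstarM lmulA row_row (negPf bc) mulr0z lmul0l.
Qed.

Lemma basis_mx_rooted (B B' : {fset walk G}) (k : B -> B' -> int) :
  maximal_basis R [set` B] -> maximal_basis R [set` B'] ->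
  (forall b b', wT (val b) <> wT (val b') -> k b b' = 0) ->
  rooted_lpa R (basis_mx k).
Proof.
move=> [BR _ _] [B'R _ _] kT; have [M0 MD] := rooted_lpa_Zsubmodule R.
have MA x y : rooted_lpa R x -> rooted_lpa R y -> rooted_lpa R (x + y).
  by move=> Mx My; have := MD 1 x y Mx My.
rewrite /basis_mx; elim/big_ind: _ => // b _; elim/big_ind: _ => // b' _.
have [bb'|/kT ->] := pselect (wT (val b) = wT (val b')); last exact: M0.
rewrite -[X in rooted_lpa R X]addr0; apply: MD => //; apply: sub_gen_smallest.
exists (val b), (val b'); split=> //.
- exact: (BR _ (valP b)).
- exact: (B'R _ (valP b')).
Qed.

Lemma unitary_basis_mx x : unitary_group R x ->
  exists (B B' : {fset walk G}) (k : B -> B' -> int),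
    [/\ maximal_basis R [set` B],
        maximal_basis R [set` B'],
        orthogonal_mx k,
        (forall b b', wT (val b) <> wT (val b') -> k b b' = 0) &
        x = basis_mx k].
Proof.
move=> [xR xx' x'x]; have [N xN] := rooted_lpa_mul_path xR.
pose D := fset_set (level R N).
have DE : [set` D] = level R N by apply/fset_setK/finite_level.
have maxD : maximal_basis R [set` D] by rewrite DE; exact: level_maximal_basis.
have [DR indD _] := maxD; have sumD := lvert_basis_sum maxD.
have /choice[f fP] (d : D) : exists pk : walk G * int, [/\ wO pk.1 = R,
    wT pk.1 = wT (val d), pk.2 * pk.2 = 1 & lmul x (lpath (val d)) = lpath pk.1 *~ pk.2].
  have dR : wO (val d) = R := DR _ (valP d).
  have := path_comb_isometry (xN _ dR _).
  case=> [||p [k [pR pT kk xd]]]; last by exists (p, k).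
  - have [_] : level R N (val d) by rewrite -DE; apply: (valP d).
    by case=> [->|[_ sd]]; [left|right].
  - rewrite lstarM -lmulA [lmul (lstar x) _]lmulA x'x -dR lvert_lpath.
    exact: star_lpath.
pose p d := (f d).1; pose s d := (f d).2.
have ss d : s d * s d = 1 by case: (fP d).
have pR d : wO (p d) = R by case: (fP d).
have pT d : wT (p d) = wT (val d) by case: (fP d).
have xd d : lmul x (lpath (val d)) = lpath (p d) *~ s d by case: (fP d).
(* Up to sign, [p_d^* p_d'] equals [d^* x^* x d' = d^* d'], which is 0 for [d != d']. This gives
   independence and injectivity of [p] at once. *)
have p_indep d d' : wprefix (p d) (p d') -> d = d'.
  move=> pdd'; apply/eqP; apply: contraTT (star_lpath_neq0 pdd') => dd'.
  rewrite negbK.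
  have : lmul (lstar (lmul x (lpath (val d)))) (lmul x (lpath (val d'))) = 0.
    rewrite lstarM -lmulA [lmul (lstar x) _]lmulA x'x -(DR _ (valP d')) lvert_lpath.
    rewrite (star_lpath_indep DR indD (valP d) (valP d')).
    by rewrite (inj_eq val_inj) (negPf dd').
  rewrite !xd (raddfMz (@lstar G)) lmulMzl (raddfMz (lmul _)) /= -mulrzA.
  (* Multiplying by the signs once more removes them, as each squares to 1. *)
  move/(congr1 (fun y => y *~ (s d * s d'))); rewrite mul0rz -mulrzA.
  by rewrite mulrACA [s d' * s d]mulrC mulrACA !ss mulr1 mulr1z => ->.
pose B := [fset p d | d : D]%fset.
have pB d : p d \in B by apply: in_imfset.
(* [g] and [h] are inverse bijections between [D] and [B], by which sums over [B] are reindexed. *)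
pose g d : B := [` pB d]%fset.
have /choice[h hP] (b : B) : exists d, p d = val b.
  by have /imfsetP[d _ ->] := valP b; exists d.
have gK : cancel g h by move=> d; apply: p_indep; rewrite hP; apply: wprefix_refl.
have hK : cancel h g by move=> b; apply: val_inj; rewrite /= hP.
have sumB (V : nmodType) (F : B -> V) : \sum_b F b = \sum_d F (g d).
  by rewrite (reindex g) //; apply: onW_bij; exists h.
have sum_pp : lvert R = \sum_d lmul (lpath (p d)) (lstar (lpath (p d))).
  rewrite -xx' -{1}(rooted_lpa_mulR xR) sumD big_seq_fsetE (raddf_sum (lmul _)) lmul_suml.
  apply: eq_bigr => d _; rewrite /= lmulA -lmulA -lstarM xd (raddfMz (@lstar G)).
  by rewrite lmulMzl (raddfMz (lmul _)) /= -mulrzA ss.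
(* The signed permutation matrix whose row [b] has the sign of [h b] in column [h b]. *)
exists B, D, (fun b d => (h b == d)%:R * s d); split=> //.
- apply/maximal_basisP; split=> [b /= /imfsetP[d _ ->]|b c /= /imfsetP[d _ ->]|q qR].
  + exact: pR.
  + by move=> /imfsetP[d' _ ->] /p_indep ->.
  (* If [q] were incomparable with every [p_d], then [T(q) = q^* R q] would be the sum of
     [q^* p_d p_d^* q], which is 0. *)
  + apply: contrapT => nq; have := lvert_neq0 (wT q).
    rewrite -star_lpath -{2}(lvert_lpath q) qR sum_pp lmul_suml raddf_sum big1 ?eqxx //.
    move=> d _ /=; rewrite !lmulA star_lpath0 ?lmul0l // ?pR ?qR // => qd; apply: nq;
      by exists (p d); [exact: pB|auto].
- split=> [i j|d d'].
  + rewrite (bigD1 (h i)) //= big1 => [|d di]; last by rewrite eq_sym (negPf di) !mul0r.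
    rewrite eqxx mul1r addr0 (can_eq hK) eq_sym.
    by case: eqP => _; rewrite ?mul1r ?ss // mul0r mulr0.
  + rewrite sumB (bigD1 d) //= big1 => [|e ed].
      rewrite gK eqxx mul1r addr0.
      by case: eqP => [<-|_]; rewrite ?mul1r ?ss // mul0r mulr0.
    by rewrite gK (negPf ed) !mul0r.
- move=> b d bd; case: eqP => [hbd|]; last by rewrite mul0r.
  by case: bd; rewrite -hP hbd pT.
(* Here [x = x R] is the sum of [x d d^*], with [x d] the signed path [p_d]. *)
- rewrite -{1}(rooted_lpa_mulR xR) sumD big_seq_fsetE (raddf_sum (lmul _)) /=.
  rewrite /basis_mx sumB; apply: eq_bigr => d _; rewrite (bigD1 d) //= big1 => [|e ed].
    by rewrite gK eqxx mul1r addr0 lmulA xd lmulMzl.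
  by rewrite gK eq_sym (negPf ed) mul0r mulr0z.
Qed.

End Unitaries.

Theorem lemma7 (G : graph) (R : VG G) (hR : is_root R) :
  unitary_group R =
  [set x : lpa G |
    exists (B B' : {fset walk G}) (k : B -> B' -> int),
      [/\ maximal_basis R [set` B],
          maximal_basis R [set` B'],
          orthogonal_mx k,
          (forall (b : B) (b' : B'), wT (val b) <> wT (val b') -> k b b' = 0) &
          x = \sum_(b : B) \sum_(b' : B')
                lmul (lpath (val b)) (lstar (lpath (val b'))) *~ k b b']].
Proof.
apply/seteqP; split=> [x /unitary_basis_mx //|x /=].
move=> [B [B' [k [maxB maxB' [kk kk'] kT ->]]]]; rewrite -/(basis_mx k).
split; [exact: basis_mx_rooted|exact: basis_mx_star|].
(* With [y = x^*], the product [x^* x] is [y y^*], and [y] is given by the transposed matrix. *)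
rewrite -{2}(lstarK (basis_mx k)) lstar_basis_mx.
by apply: basis_mx_star => // b' b /nesym; apply: kT.
Qed.
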